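(* Let $0<p<1$, let $\{\widetilde S_n,\ n\ge 1\}$ be the elephant random walk with full memory, parameter $p$ and first step $\widetilde X_1\equiv 1$, let $R$ be a real random variable independent of $\{\widetilde X_n,\ n\ge 1\}$, and put $S_n=R\,\widetilde S_n$ for $n\ge 1$. Then: (a) if $0<p<3/4$, then $\dfrac{S_n}{n}\to 0$ almost surely as $n\to\infty$; (b) if $p=3/4$, then $\dfrac{S_n}{\sqrt n\,\log n}\to 0$ almost surely as $n\to\infty$; (c) if $3/4<p<1$, then $\dfrac{S_n}{n^{2p-1}}\to R\,L$ almost surely as $n\to\infty$, where $L$ is a non-degenerate random variable.
   Context: Elephant random walk with full memory, parameter $p$ and $\widetilde X_1\equiv 1$: for each $n\ge 1$, given $\widetilde X_1,\dots,\widetilde X_n$, choose an index $K$ uniformly on $\{1,\dots,n\}$ and set $\widetilde X_{n+1}=\widetilde X_K$ with probability $p$ and $\widetilde X_{n+1}=-\widetilde X_K$ with probability $1-p$ (the index and the sign being chosen independently of each other and of the past). The walk is $\widetilde S_n=\sum_{k=1}^n\widetilde X_k$. Thus $S_n=\sum_{k=1}^n X_k$ with steps $X_k=R\,\widetilde X_k$. *)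

(* Defs.v *)
From HB Require Import structures.
From mathcomp Require Import all_boot all_order all_algebra.
From mathcomp Require Import all_classical all_reals all_analysis.
Set Implicit Arguments.
Unset Strict Implicit.
Unset Printing Implicit Defensive.
Import Order.TTheory GRing.Theory Num.Theory.
Import numFieldNormedType.Exports.
Local Open Scope classical_set_scope.
Local Open Scope ring_scope.

Definition sigma_of d d' (T : measurableType d) (T' : measurableType d')
    (Y : T -> T') : set (set T) :=
  preimage_set_system setT Y measurable.

(* sigma-algebra generated by the variables X k with k in D *)
Definition sigma_family d d' (T : measurableType d) (T' : measurableType d')
    (X : nat -> T -> T') (D : set nat) : set (set T) :=
  <<s \bigcup_(k in D) sigma_of (X k) >>.

Definition independent2 d (T : measurableType d) (R : realType)
    (P : probability T R) (F G : set (set T)) : Prop :=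
  forall A B, F A -> G B -> P (A `&` B) = (P A * P B)%E.

(* Mutual independence of three sigma-algebras: as each of them contains setT,
   the triple product rule entails the pairwise ones. *)
Definition independent3 d (T : measurableType d) (R : realType)
    (P : probability T R) (F G H : set (set T)) : Prop :=
  forall A B C, F A -> G B -> H C ->
    P (A `&` B `&` C) = (P A * P B * P C)%E.

(* The steps are X 1, X 2, ...; the value X 0 is never used.  The variable
   K n is the index drawn at time n, and keep n tells whether the step X (K n)
   is repeated (true) or reversed (false). *)
Definition elephant_random_walk d (T : measurableType d) (R : realType)
    (P : probability T R) (p : R) (X : nat -> {RV P >-> R}) : Prop :=
  (forall w, X 1%N w = 1) /\
  exists (K : nat -> {RV P >-> nat}) (keep : nat -> {RV P >-> bool}),
    forall n, (1 <= n)%N ->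
    [/\ forall k, (1 <= k <= n)%N -> P (K n @^-1` [set k]) = (n%:R^-1)%:E,
        P (keep n @^-1` [set true]) = p%:E,
        P (keep n @^-1` [set false]) = (1 - p)%:E,
        independent3 P
          (sigma_family (fun k => X k : T -> R) [set k | (1 <= k <= n)%N])
          (sigma_of (K n)) (sigma_of (keep n))
      & forall w, X n.+1 w = if keep n w then X (K n w) w else - X (K n w) w].

Definition position d (T : measurableType d) (R : realType)
    (P : probability T R) (X : nat -> {RV P >-> R}) (n : nat) (w : T) : R :=
  \sum_(1 <= k < n.+1) X k w.

Definition nondegenerate_rv d (T : measurableType d) (R : realType)
    (P : probability T R) (L : {RV P >-> R}) : Prop :=
  forall c : R, ~ {ae P, forall w, L w = c}.

Arguments elephant_random_walk {d T R} P p X.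
Arguments position {d T R} P X n w.
Arguments nondegenerate_rv {d T R} P L.

(* Main.v *)
(** Write [a = 2p - 1].  The position of the elephant is an inhomogeneous Markov
    chain: from [s] at time [n] it moves to [s + 1] with probability
    [(1 + a s / n) / 2], because a uniformly chosen past step has mean [s / n].
    If [G(n, s) >= 0] is superharmonic for this chain, induction on the horizon
    gives the maximal inequality [P(sup_j G(j, S_j) >= l) <= G(n, s) / l] for the
    walk started at [s] at time [n], with no integration theory.

    For [a <= 1/2] one takes [G = s^2 / (n ln^2 n) + 1 / ln n] after time [m],
    continued before time [m] by the superharmonic function [s^2 / n - ln n]
    suitably normalised; the value at the start tends to 0 as [m] grows, so
    [S_n / (sqrt n ln n) -> 0], which covers (b) and also (a).

    For [a > 1/2], [M_n = S_n / growth a n] is a martingale; applied to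
    [(s / growth a n - r)^2 + O(n^(1-2a))] the maximal inequality shows that
    [M_n] is almost surely Cauchy, and [growth a n / n^a] converges by Bernoulli's
    inequality.  The limit is unbounded, hence non-degenerate: with positive
    probability the first [m] steps are all [+1], which makes
    [M_m = m / growth a m] arbitrarily large, and from there [M] moves by less
    than 1 with positive conditional probability. *)

Require Import Defs.
From HB Require Import structures.
From mathcomp Require Import all_boot all_order all_algebra.
From mathcomp Require Import all_classical all_reals all_analysis.
From mathcomp Require Import measurable_realfun.
From mathcomp Require Import ring lra.
Set Implicit Arguments.
Unset Strict Implicit.
Unset Printing Implicit Defensive.
Import Order.TTheory GRing.Theory Num.Theory.
Import numFieldNormedType.Exports.
Local Open Scope classical_set_scope.
Local Open Scope ring_scope.

(** * Elementary inequalities for powers and logarithms *)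

(** Bernoulli's inequality for an exponent below 1, read off Young's inequality for the product of
    [x ^ b] and 1 with conjugate exponents [1 / b] and [1 / (1 - b)]. *)
Lemma powR_le1DZ (R : realType) (b x : R) :
  0 < b < 1 -> 0 <= x -> x `^ b <= 1 + b * (x - 1).
Proof.
move=> /andP[b0 b1] x0.
have b'0 : 0 < 1 - b by rewrite subr_gt0.
have := @conjugate_powR R (x `^ b) 1 b^-1 (1 - b)^-1 (powR_ge0 _ _) ler01.
rewrite !invr_gt0 !invrK => /(_ b0 b'0); rewrite subrKC => /(_ erefl).
rewrite -powRrM mulfV ?gt_eqF// powRr1// powR1 mulr1 mul1r => /le_trans; apply.
by lra.
Qed.

Lemma ln_succ_ge (R : realType) (n : nat) : (0 < n)%N ->
  n.+1%:R^-1 <= ln n.+1%:R - ln n%:R :> R.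
Proof.
move=> n0; have n0' : 0 < n%:R :> R by rewrite ltr0n.
have n1 : 0 < n.+1%:R :> R by [].
rewrite -opprB lerNr -ln_div ?posrE//.
have -> : n%:R / n.+1%:R = 1 + - n.+1%:R^-1 :> R.
  by rewrite -[in n%:R](addrK 1 n%:R) -natr1 mulrBl divff ?mul1r// gt_eqF// natr1.
by apply: le_ln1Dx; rewrite ltrN2 invf_lt1// ltr1n ltnS.
Qed.

Lemma ln_le_sqrt (R : realType) (x : R) : 0 < x -> ln x <= 2 * Num.sqrt x.
Proof.
move=> x0; have s0 : 0 < Num.sqrt x by rewrite sqrtr_gt0.
rewrite -[in ln x](sqr_sqrtr (ltW x0)) lnXn// mulr_natl lerMn2r /=.
exact/ltW/ln_sublinear.
Qed.

(** * Superharmonic functions and the critical potential *)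

(* [(1 + a * s / n) / 2] is the probability that the position [s] at time [n]
   increases. *)
Definition excessive {R : realType} (a : R) (m : nat) (G : nat -> R -> R) :=
  forall n s, (m <= n)%N ->
  (1 + a * s / n%:R) / 2 * G n.+1 (s + 1) +
  (1 - a * s / n%:R) / 2 * G n.+1 (s - 1) <= G n s.

(** A step has square 1 and conditional mean [a s / n], so the mean of the next squared position is
    [s^2 (1 + 2 a / n) + 1]. The coefficient of [s^2] and the constant term can then be compared
    separately. *)
Lemma excessive_quadratic (R : realType) (a : R) (m : nat) (c d : nat -> R) :
  (forall n, (m <= n)%N -> c n.+1 * (1 + 2 * a / n%:R) <= c n) ->
  (forall n, (m <= n)%N -> c n.+1 + d n.+1 <= d n) ->
  excessive a m (fun n s => c n * s ^+ 2 + d n).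
Proof.
move=> hc hd n s mn; have := hd _ mn; have := ler_wpM2r (sqr_ge0 s) (hc _ mn).
by rewrite /=; lra.
Qed.

(* Before time [m] this is [(s^2 / n - ln n + ln m) / ln^2 m + 1 / ln m],
   from time [m] on it is [s^2 / (n ln^2 n) + 1 / ln n]. *)
Definition critical_potential {R : realType} (m n : nat) (s : R) : R :=
  let l := ln (maxn n m)%:R in
  (n%:R * l ^+ 2)^-1 * s ^+ 2 + (l^-1 + (l - ln n%:R) / ln m%:R ^+ 2).

Lemma excessive_critical (R : realType) (a : R) (m : nat) :
  (1 < m)%N -> a <= 1 / 2 -> excessive a 1 (critical_potential m).
Proof.
move=> m1 ha.
have lnm (k : nat) : 0 < ln (maxn k m)%:R :> R.
  by rewrite ln_gt0// ltr1n leq_max m1 orbT.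
have lm0 : 0 < ln m%:R :> R by rewrite ln_gt0// ltr1n.
apply: excessive_quadratic => n n1.
- have n0 : 0 < n%:R :> R by rewrite ltr0n.
  have n0' : 0 < n.+1%:R :> R by [].
  have l0 := lnm n; have l0' := lnm n.+1.
  have ll : ln (maxn n m)%:R <= ln (maxn n.+1 m)%:R :> R.
    rewrite ler_ln ?posrE ?ltr0n ?leq_max ?(ltnW m1) ?orbT// ler_nat.
    by rewrite geq_max !leq_max leqnSn leqnn orbT.
  set l := ln (maxn n m)%:R in l0 ll *; set l' := ln _%:R in l0' ll *.
  rewrite [(_ * l' ^+ 2)^-1]invfM [(_ * l ^+ 2)^-1]invfM mulrAC.
  have h1 : l' ^- 2 <= l ^- 2.
    by rewrite lef_pV2 ?posrE ?exprn_gt0// ler_pXn2r// nnegrE ltW.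
  (* The bound [a <= 1 / 2] enters here: it gives [1 + 2 a / n <= (n + 1) / n]. *)
  have h2 : n.+1%:R^-1 * (1 + 2 * a / n%:R) <= n%:R^-1.
    rewrite ler_pdivrMl// -(natr1 n) [leRHS]mulrDl divff ?gt_eqF// mul1r lerD2l.
    by rewrite ler_piMl ?invr_ge0 ?ler0n//; lra.
  apply: (@le_trans _ _ (n%:R^-1 * l' ^- 2)).
    by rewrite ler_wpM2r// invr_ge0 exprn_ge0// ltW.
  by rewrite ler_wpM2l// invr_ge0 ltW.
- have n0 : 0 < n%:R :> R by rewrite ltr0n.
  have := @ln_succ_ge R n n1.
  have [nm|mn] := ltnP n m.
    (* Since [n + 1 <= m], the logarithm [l] is frozen at [ln m] and the growth of [ln n] alone pays
       for the new constant [1 / ((n + 1) ln^2 m)]. *)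
    rewrite (maxn_idPr nm) => h.
    have v0 : 0 <= ln m%:R ^- 2 :> R by rewrite invr_ge0 exprn_ge0// ltW.
    have := ler_wpM2r v0 h; rewrite [(_ * _ ^+ 2)^-1]invfM.
    have aux (u v w x y z : R) :
      w * v <= (y - x) * v -> w * v + (u + (z - y) * v) <= u + (z - x) * v by lra.
    exact: aux.
  (* From time [m] on the correction vanishes and the drop of [1 / ln] has to pay:
     [(l' - l) / (l l') >= 1 / ((n + 1) l'^2)]. *)
  rewrite (maxn_idPl (leqW mn)) !subrr !mul0r !addr0 => h.
  have l0 : 0 < ln n%:R :> R by have := lnm n; rewrite (maxn_idPl mn).
  have l0' : 0 < ln n.+1%:R :> R by have := lnm n.+1; rewrite (maxn_idPl (leqW mn)).
  set l := ln n%:R in l0 h *; set l' := ln n.+1%:R in l0' h *.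
  have ll : l <= l' by rewrite -subr_ge0; apply: le_trans h; rewrite invr_ge0.
  rewrite -lerBrDr.
  have -> : l^-1 - l'^-1 = (l' - l) * (l * l')^-1.
    by field; rewrite !gt_eqF.
  rewrite invfM; apply: ler_pM; rewrite ?invr_ge0 ?exprn_ge0//; first exact: ltW.
  by rewrite lef_pV2 ?posrE ?exprn_gt0 ?mulr_gt0// expr2 ler_wpM2r// ltW.
Qed.

Lemma critical_potential_ge0 (R : realType) (m n : nat) (s : R) :
  (1 < m)%N -> (0 < n)%N -> 0 <= critical_potential m n s.
Proof.
move=> m1 n0.
have l0 : 0 <= ln (maxn n m)%:R :> R.
  by rewrite ln_ge0// ler1n leq_max n0.
apply: addr_ge0; first by rewrite mulr_ge0 ?sqr_ge0// invr_ge0 mulr_ge0 ?sqr_ge0.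
apply: addr_ge0; first by rewrite invr_ge0.
apply: mulr_ge0; last by rewrite invr_ge0 sqr_ge0.
by rewrite subr_ge0 ler_ln ?posrE ?ltr0n ?leq_max ?n0// ler_nat leq_maxl.
Qed.

(** For [m > 1] the value at the start is [1 / ln^2 m + 2 / ln m]. It is the numerator of the bound
    in the maximal inequality. *)
Lemma critical_potential_cvg0 (R : realType) :
  critical_potential m 1%N (1 : R) @[m --> \oo] --> (0 : R).
Proof.
have lnV0 : (ln m%:R)^-1 @[m --> \oo] --> (0 : R).
  apply/gtr0_cvgV0; last first.
    apply/cvgryPge => A; near=> m.
    rewrite -[A]expRK ler_ln ?posrE ?expR_gt0//.
      by near: m; apply: nbhs_infty_ger.
    by rewrite ltr0n; near: m; exact: nbhs_infty_gt.
  near=> m; rewrite ln_gt0// ltr1n; near: m; exact: nbhs_infty_gt.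
suff : ((ln m%:R)^-1 ^+ 2 + ((ln m%:R)^-1 + (ln m%:R)^-1)) @[m --> \oo] -->
    ((0 : R) ^+ 2 + (0 + 0)).
  rewrite !addr0 expr0n/=; apply: cvg_trans; apply: near_eq_cvg.
  near=> m; rewrite /critical_potential.
  have m1 : (1 < m)%N by near: m; exact: nbhs_infty_gt.
  have l0 : ln m%:R != 0 :> R by rewrite gt_eqF// ln_gt0// ltr1n.
  rewrite (maxn_idPr (ltnW m1)) ln1; field.
  exact: l0.
apply: cvgD; last exact: cvgD.
exact: (cvgM lnV0 lnV0).
Unshelve. all: by end_near. Qed.

(** * Asymptotics of the mean position *)

Lemma powR_cvg_pinfty (R : realType) (b : R) : 0 < b ->
  n%:R `^ b @[n --> \oo] --> +oo.
Proof.
move=> b0; apply/cvgryPge => A; near=> n.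
rewrite (le_trans (ler_norm A))//.
have -> : `|A| = (`|A| `^ b^-1) `^ b.
  by rewrite -powRrM mulVf ?powRr1// lt0r_neq0.
apply: ge0_ler_powR; rewrite ?nnegrE ?powR_ge0 ?ler0n ?(ltW b0)//.
by near: n; exact: nbhs_infty_ger.
Unshelve. all: by end_near. Qed.

Lemma invr_cvg0 (R : realType) (u : nat -> R) :
  u n @[n --> \oo] --> +oo -> (u n)^-1 @[n --> \oo] --> 0.
Proof.
move=> u_oo; apply/gtr0_cvgV0; last exact: u_oo.
by have /cvgryPgt := u_oo; apply.
Qed.

(* The mean of the position at time [n], since the first step is 1. *)
Definition growth {R : realType} (a : R) (n : nat) : R :=
  \prod_(1 <= k < n) (1 + a / k%:R).

Lemma growth1 (R : realType) (a : R) : growth a 1 = 1.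
Proof. by rewrite /growth big_geq. Qed.

Lemma growthS (R : realType) (a : R) (n : nat) : (0 < n)%N ->
  growth a n.+1 = growth a n * (1 + a / n%:R).
Proof. by move=> n0; rewrite /growth big_nat_recr. Qed.

Lemma growth_gt0 (R : realType) (a : R) (n : nat) : 0 <= a -> 0 < growth a n.
Proof.
by move=> a0; apply: prodr_gt0 => k _; rewrite ltr_pwDl// divr_ge0.
Qed.

(** Bernoulli's inequality at [n / (n + 1)]; the next lemma uses it at [(n + 1) / n]. *)
Lemma powR_pred_le (R : realType) (b : R) (n : nat) : 0 < b < 1 ->
  n%:R `^ b <= n.+1%:R `^ b * (1 - b / n.+1%:R).
Proof.
move=> hb; have n0 : 0 < n.+1%:R :> R by [].
have -> : n%:R = n.+1%:R * (n%:R / n.+1%:R) :> R.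
  by rewrite mulrCA divff ?mulr1// gt_eqF.
have q0 : 0 <= n%:R / n.+1%:R :> R by rewrite divr_ge0.
rewrite powRM//; apply: ler_wpM2l; first exact: powR_ge0.
apply: (le_trans (powR_le1DZ hb q0)).
rewrite le_eqVlt; apply/orP; left; apply/eqP.
by rewrite -(natr1 n); field; rewrite natr1 gt_eqF.
Qed.

Lemma powR_succ_le (R : realType) (b : R) (n : nat) : 0 < b < 1 -> (0 < n)%N ->
  n.+1%:R `^ b <= n%:R `^ b * (1 + b / n%:R).
Proof.
move=> hb n1; have n0 : 0 < n%:R :> R by rewrite ltr0n.
have -> : n.+1%:R = n%:R * (n.+1%:R / n%:R) :> R.
  by rewrite mulrCA divff ?mulr1// gt_eqF.
have q0 : 0 <= n.+1%:R / n%:R :> R by rewrite divr_ge0.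
rewrite powRM//; apply: ler_wpM2l; first exact: powR_ge0.
apply: (le_trans (powR_le1DZ hb q0)).
rewrite le_eqVlt; apply/orP; left; apply/eqP.
by rewrite -(natr1 n); field; rewrite gt_eqF.
Qed.

Lemma powR_le_growth (R : realType) (a : R) (n : nat) : 0 < a < 1 -> (0 < n)%N ->
  n%:R `^ a <= growth a n.
Proof.
move=> ha; elim: n => // -[_ _|n IH _]; first by rewrite growth1 powR1.
apply: (le_trans (powR_succ_le ha _)) => //.
rewrite growthS// ler_wpM2r ?IH//.
by have /andP[a0 _] := ha; rewrite addr_ge0// divr_ge0// ltW.
Qed.

(** The constant 2 bounds [growth a 2 = 1 + a]. With the index shifted by one, the induction step
    costs a factor [(1 - t) (1 + t) <= 1]. *)
Lemma growth_le_powR (R : realType) (a : R) (n : nat) : 0 < a < 1 -> (0 < n)%N ->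
  growth a n.+1 <= 2 * n%:R `^ a.
Proof.
move=> ha; have /andP[a0 a1] := ha.
elim: n => // -[_ _|n IH _].
  by rewrite growthS// growth1 powR1 divr1; lra.
rewrite growthS//; set t := a / n.+2%:R.
have t0 : 0 <= t by rewrite divr_ge0// ltW.
apply: (@le_trans _ _ (2 * n.+1%:R `^ a * (1 + t))).
  by rewrite ler_wpM2r ?IH// addr_ge0.
rewrite -mulrA ler_wpM2l//.
apply: (@le_trans _ _ (n.+2%:R `^ a * (1 - t) * (1 + t))).
  by rewrite ler_wpM2r ?addr_ge0//; exact: powR_pred_le.
rewrite -mulrA ler_piMr ?powR_ge0//.
by have := sqr_ge0 t; lra.
Qed.

(** The ratio is nondecreasing by Bernoulli's inequality and lies between 1 and 2; the lower bound
    makes the limit positive. *)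
Lemma growth_powR_cvg (R : realType) (a : R) : 0 < a < 1 ->
  exists2 kappa : R, 0 < kappa &
    growth a n / n%:R `^ a @[n --> \oo] --> kappa.
Proof.
move=> ha; have /andP[a0 a1] := ha.
(* The shift avoids index 0, where the denominator is 0. *)
pose u n := growth a n.+1 / n.+1%:R `^ a.
have pw (n : nat) : 0 < n.+1%:R `^ a :> R by rewrite powR_gt0.
have u1 n : 1 <= u n by rewrite /u ler_pdivlMr ?mul1r ?powR_le_growth.
have ndu : nondecreasing_seq u.
  apply/nondecreasing_seqP => n.
  rewrite /u ler_pdivrMr// mulrAC ler_pdivlMr// (growthS a (n := n.+1))// -mulrA.
  rewrite ler_pM2l ?(growth_gt0 _ (ltW a0))// mulrC.
  exact: powR_succ_le.
have ubu : has_ubound (range u).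
  exists 2 => _ [[|n] _ <-]; rewrite /u ler_pdivrMr//.
    by rewrite growth1 powR1 mulr1 ler1n.
  apply: (le_trans (growth_le_powR ha _)) => //.
  by rewrite ler_pM2l// ge0_ler_powR ?nnegrE ?ltW// ltr_nat.
have cu := nondecreasing_is_cvgn ndu ubu.
exists (limn u); last by rewrite -(cvg_shiftS (fun n => growth a n / n%:R `^ a)).
by apply: (lt_le_trans ltr01); apply: limr_ge => //; exact: nearW.
Qed.

(** The ratio is the value of the martingale after [n] steps [+1]; it is at least
    [n^(1 - a) / 2]. *)
Lemma id_over_growth_cvg (R : realType) (a : R) : 0 < a < 1 ->
  n%:R / growth a n @[n --> \oo] --> +oo.
Proof.
move=> ha; have /andP[a0 a1] := ha.
have a1' : 0 < 1 - a by rewrite subr_gt0.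
have /cvgryPge h := powR_cvg_pinfty a1'.
apply/cvgryPge => A; near=> n.
have n0 : (0 < n)%N by near: n; exact: nbhs_infty_gt.
have n0' : 0 < n%:R :> R by rewrite ltr0n.
apply: (@le_trans _ _ (n%:R `^ (1 - a) / 2)).
  by rewrite ler_pdivlMr//; near: n; exact: h.
rewrite ler_pdivlMr ?(growth_gt0 _ (ltW a0))// mulrAC ler_pdivrMr//.
have -> : n%:R * 2 = n%:R `^ (1 - a) * (2 * n%:R `^ a) :> R.
  by rewrite mulrCA -powRD ?subrK ?gt_eqF// ?powRr1 ?ltW// mulrC.
rewrite ler_wpM2l ?powR_ge0//.
apply: le_trans (growth_le_powR ha n0).
rewrite growthS// ler_peMr ?(ltW (growth_gt0 _ (ltW a0)))//.
by rewrite lerDl divr_ge0// ltW.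
Unshelve. all: by end_near. Qed.

(** * Variance of the supercritical martingale *)

(* Bounds the variance still to come after time n of the martingale
   [s / growth a n]. *)
Definition tail_variance {R : realType} (a : R) (n : nat) : R :=
  ((2 * a - 1) * n%:R `^ (2 * a - 1))^-1.

Lemma tail_variance_ge0 (R : realType) (a : R) (n : nat) : 1 / 2 < a ->
  0 <= tail_variance a n.
Proof. by move=> ha; rewrite invr_ge0 mulr_ge0 ?powR_ge0//; lra. Qed.

Lemma tail_variance_cvg0 (R : realType) (a : R) : 1 / 2 < a ->
  tail_variance a n @[n --> \oo] --> 0.
Proof.
move=> ha; have b0 : 0 < 2 * a - 1 by lra.
rewrite -[X in _ --> X](mulr0 (2 * a - 1)^-1); rewrite /tail_variance.
under eq_fun do rewrite invfM.
by apply: cvgMr; exact/invr_cvg0/powR_cvg_pinfty.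
Qed.

(** Discrete form of an integral comparison: [tail_variance a n] is the integral of [x^(-2a)] from
    [n] to infinity, and [growth a n.+1 ^+ 2] is at least [(n + 1)^(2a)]. *)
Lemma growth_variance_le (R : realType) (a : R) (n : nat) :
  1 / 2 < a < 1 -> (0 < n)%N ->
  growth a n.+1 ^- 2 <= tail_variance a n - tail_variance a n.+1.
Proof.
move=> /andP[ha a1] n0; rewrite /tail_variance.
have n0' : 0 < n%:R :> R by rewrite ltr0n.
have n1 : 0 < n.+1%:R :> R by [].
set b := 2 * a - 1.
have hb : 0 < b < 1 by rewrite /b; apply/andP; split; lra.
have /andP[b0 b1] := hb.
have hx := powR_pred_le n hb.
have x0 : 0 < n%:R `^ b by rewrite powR_gt0.
have y0 : 0 < n.+1%:R `^ b by rewrite powR_gt0.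
have g0 : 0 < growth a n.+1 by rewrite growth_gt0//; lra.
have hg : n.+1%:R `^ b * n.+1%:R <= growth a n.+1 ^+ 2.
  have -> : n.+1%:R `^ b * n.+1%:R = (n.+1%:R `^ a) ^+ 2.
    rewrite -powR_mulrn ?powR_ge0// -powRrM.
    have -> : a * 2%:R = b + 1 by rewrite /b; lra.
    by rewrite [RHS]powRD ?(lt0r_neq0 n1) ?implybT// powRr1// ltW.
  rewrite ler_pXn2r ?nnegrE ?powR_ge0 ?(ltW g0)//.
  by rewrite powR_le_growth//; apply/andP; split; lra.
apply: (@le_trans _ _ ((n.+1%:R `^ b * n.+1%:R)^-1)).
  by rewrite lef_pV2// posrE ?exprn_gt0 ?mulr_gt0.
set x := n%:R `^ b in x0 hx *; set y := n.+1%:R `^ b in y0 hx hg *.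
set N := n.+1%:R in n1 hx hg *.
have -> : (b * x)^-1 - (b * y)^-1 = (y - x) / (b * x * y).
  by field; rewrite !gt_eqF.
rewrite ler_pdivlMr ?mulr_gt0// ler_pdivrMl ?mulr_gt0//.
have hx' : y * b <= N * (y - x).
  have := ler_wpM2l (ltW n1) hx.
  have -> : N * (y * (1 - b / N)) = N * y - y * b by field; rewrite gt_eqF.
  lra.
have yx : x <= y.
  by rewrite -subr_ge0 -(pmulr_rge0 _ n1) (le_trans _ hx')// mulr_ge0 ?ltW.
apply: (@le_trans _ _ (y * (y * b))).
  by rewrite mulrC ler_pM2l// mulrC ler_pM2r.
by rewrite -mulrA ler_pM2l.
Qed.

Lemma excessive_martingale (R : realType) (a r : R) : 1 / 2 < a < 1 ->
  excessive a 1 (fun n s => (s / growth a n - r) ^+ 2 + tail_variance a n).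
Proof.
move=> ha n s n0; have := growth_variance_le ha n0.
have n0' : 0 < n%:R :> R by rewrite ltr0n.
have g0 : 0 < growth a n by rewrite growth_gt0//; lra.
have t0 : 0 < 1 + a / n%:R by rewrite ltr_pwDl// divr_ge0//; lra.
rewrite growthS//; set A := growth a n in g0 *.
set t := a / n%:R in t0 *; have -> : a * s / n%:R = t * s by rewrite mulrAC.
move: (tail_variance _ _) (tail_variance _ _) => u v uv.
set B := A * (1 + t) in uv *.
have B0 : 0 < B by rewrite mulr_gt0.
(* Over the common denominator [B], the numerator [s (1 + t)] is the mean of the next position: this
   is the martingale property. *)
have -> : s / A = s * (1 + t) / B by rewrite /B; field; rewrite !gt_eqF.
rewrite -exprVn in uv; set i := B^-1 in uv *.
(* The increment has conditional variance [(1 - (t s)^2) / B^2], which is at most [1 / B^2] and so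
   at most [u - v]. *)
have := sqr_ge0 (t * s * i); move: uv.
move: i => i.
lra.
Qed.

(** * Real-valued probabilities and almost sure events *)

(** Real values let sums and products of probabilities be treated by [lra]. *)
Definition prob d (T : measurableType d) (R : realType) (P : probability T R)
  (A : set T) : R := fine (P A).

Lemma probE d (T : measurableType d) (R : realType) (P : probability T R)
  (A : set T) : measurable A -> P A = (prob P A)%:E.
Proof. by move=> mA; rewrite /prob fineK// fin_num_measure. Qed.

Lemma prob_ge0 d (T : measurableType d) (R : realType) (P : probability T R)
  (A : set T) : 0 <= prob P A.
Proof. exact: fine_ge0. Qed.

Lemma le_prob d (T : measurableType d) (R : realType) (P : probability T R)
  (A B : set T) : measurable A -> measurable B -> A `<=` B -> prob P A <= prob P B.
Proof. by move=> mA mB AB; rewrite -lee_fin -!probE// le_measure ?inE. Qed.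

Lemma prob_split d (T : measurableType d) (R : realType) (P : probability T R)
    (A B : set T) : measurable A -> measurable B ->
  prob P A = prob P (A `&` B) + prob P (A `&` ~` B).
Proof.
move=> mA mB; have mB' := measurableC mB; apply: EFin_inj.
rewrite EFinD -!probE//; try exact: measurableI.
rewrite -measureU//; try exact: measurableI.
  by rewrite -setIUr setUv setIT.
by rewrite setIACA setICr setI0.
Qed.

(** Total probability over the drawn index. The last term remains because [K] may take any natural
    value. *)
Lemma prob_partition d (T : measurableType d) (R : realType)
    (P : probability T R) (K : {RV P >-> nat}) (A : set T) (n : nat) :
  measurable A ->
  prob P A = \sum_(1 <= k < n.+1) prob P (A `&` K @^-1` [set k])
           + prob P (A `&` K @^-1` [set k | ~~ (1 <= k <= n)%N]).
Proof.
move=> mA; have mK B : measurable (K @^-1` B).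
  by rewrite -[X in measurable X]setTI; exact: measurable_funP.
elim: n => [|n IH].
  rewrite big_geq// add0r; congr prob; apply/seteqP.
  by split=> [w Aw|w []//]; split=> //=; case: (K w).
rewrite IH [in RHS]big_nat_recr//= -addrA; congr +%R.
rewrite (prob_split P _ (mK [set n.+1])); last exact: measurableI.
congr (prob P _ + prob P _); apply/seteqP; split => w /=.
- by move=> [[]].
- by move=> [Aw ->]; rewrite ltnn andbF.
- move=> [[Aw h] nK]; split => //; apply: contra h => /andP[-> /=].
  by rewrite leq_eqVlt ltnS => /predU1P[|//].
- move=> [Aw h]; split; first split => //.
    by apply: contra h => /andP[-> /leqW].
  by move=> Kn; move: h; rewrite Kn leqnn.
Qed.

Lemma prob_bigcup_le d (T : measurableType d) (R : realType)
    (P : probability T R) (F : (set T)^nat) (c : R) :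
  (forall n, measurable (F n)) -> nondecreasing_seq F ->
  (forall n, prob P (F n) <= c) -> prob P (\bigcup_n F n) <= c.
Proof.
move=> mF ndF Fc; have mU : measurable (\bigcup_n F n) by exact: bigcup_measurable.
rewrite -lee_fin -probE//.
have h := nondecreasing_cvg_mu (mu := P) mF mU ndF.
rewrite -(cvg_lim _ h)//; apply: lime_le.
  by apply/cvg_ex; exists (P (\bigcup_n F n)).
by apply: nearW => n /=; rewrite probE// lee_fin.
Qed.

(** Turns maximal bounds into almost sure statements: for each [j], the exceptional events of
    probability at most [1 / (i + 1)] intersect in a null set covering the failures of [Q j]. *)
Lemma ae_forall_small d (T : measurableType d) (R : realType)
    (P : probability T R) (Q : nat -> T -> Prop) :
  (forall j (e : R), 0 < e -> exists E, [/\ measurable E, prob P E <= e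
     & forall w, ~ E w -> Q j w]) ->
  {ae P, forall w, forall j, Q j w}.
Proof.
move=> h; apply: ae_foralln => j.
have /choice[E hE] : forall i : nat, exists E, [/\ measurable E,
    prob P E <= i.+1%:R^-1 & forall w, ~ E w -> Q j w].
  by move=> i; apply: h; rewrite invr_gt0.
have mE i : measurable (E i) by have [] := hE i.
have mI : measurable (\bigcap_i E i) by exact: bigcap_measurable.
exists (\bigcap_i E i); split => //.
  apply: (etrans (probE P mI)); congr EFin; apply/eqP; rewrite eq_le prob_ge0 andbT.
  apply/ler_addgt0Pr => e e0; rewrite add0r.
  have [i ie] : exists i : nat, i.+1%:R^-1 < e.
    have := @ltr_add_invr R 0 e e0 => -[i]; rewrite add0r => ?; by exists i.
  apply: (le_trans _ (ltW ie)); have [_ + _] := hE i; apply: le_trans.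
  by apply: le_prob => //; exact: bigcap_inf.
move=> w /= nQ i _; apply: contrapT => nE; apply: nQ.
by have [_ _] := hE i; apply.
Qed.

(** * Histories and the transition law *)

(** A finite history is encoded as a total function of which only the values at [1..n] count. *)
Definition cylinder T (R : realType) (X : nat -> T -> R) (n : nat)
  (x : nat -> R) : set T := [set w | forall k, (1 <= k <= n)%N -> X k w = x k].

Definition partial_sum {R : realType} (n : nat) (x : nat -> R) : R :=
  \sum_(1 <= k < n.+1) x k.

Definition signs {R : realType} (n : nat) (x : nat -> R) :=
  forall k, (1 <= k <= n)%N -> x k = 1 \/ x k = - 1.

Definition extend {R : realType} (n : nat) (x : nat -> R) (b : R) : nat -> R :=
  fun k => if k == n.+1 then b else x k.

Lemma extend_last (R : realType) (n : nat) (x : nat -> R) (b : R) :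
  extend n x b n.+1 = b.
Proof. by rewrite /extend; case: eqP. Qed.

Lemma extend_small (R : realType) (n : nat) (x : nat -> R) (b : R) (k : nat) :
  (k <= n)%N -> extend n x b k = x k.
Proof. by rewrite /extend; case: eqP => // ->; rewrite ltnn. Qed.

Lemma partial_sum_extend (R : realType) (n : nat) (x : nat -> R) (b : R) :
  partial_sum n.+1 (extend n x b) = partial_sum n x + b.
Proof.
rewrite /partial_sum big_nat_recr//=; congr (_ + _); last exact: extend_last.
by apply: eq_big_nat => k /andP[_ kn]; rewrite extend_small.
Qed.

Lemma signs_extend (R : realType) (n : nat) (x : nat -> R) (b : R) :
  signs n x -> b = 1 \/ b = - 1 -> signs n.+1 (extend n x b).
Proof.
move=> sx sb k /andP[k1]; rewrite /extend; case: eqP => // /eqP kn kn1.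
by apply: sx; rewrite k1 -ltnS ltn_neqAle kn.
Qed.

Lemma cylinder_extend T (R : realType) (X : nat -> T -> R) (n : nat)
    (x : nat -> R) (b : R) :
  cylinder X n.+1 (extend n x b) = cylinder X n x `&` X n.+1 @^-1` [set b].
Proof.
apply/seteqP; split => w /=.
  move=> h; split; last by rewrite (h n.+1) ?extend_last /= ?leqnn.
  by move=> k /andP[k1 kn]; rewrite h ?k1 ?leqW// extend_small.
move=> [h hb] k /andP[k1]; rewrite leq_eqVlt => /predU1P[->|kn].
  by rewrite extend_last.
by rewrite extend_small// h// k1.
Qed.

Lemma cylinder0 T (R : realType) (X : nat -> T -> R) (x : nat -> R) :
  cylinder X 0 x = setT.
Proof. by apply/seteqP; split => // w _ [|k]. Qed.

Lemma cylinder1 T (R : realType) (X : nat -> T -> R) (x : nat -> R) :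
  (forall w, X 1%N w = x 1%N) -> cylinder X 1 x = setT.
Proof. by move=> X1; apply/seteqP; split => // w _ [|[|k]]. Qed.

(** Places histories in the sigma-algebra of the past, as the independence hypothesis requires. The
    length [j] varies in the induction while the family up to [n] stays fixed. *)
Lemma sigma_family_cylinder d (T : measurableType d) (R : realType)
    (P : probability T R) (X : nat -> {RV P >-> R}) (n j : nat) (x : nat -> R) :
  (j <= n)%N ->
  sigma_family (fun k => X k : T -> R) [set k | (1 <= k <= n)%N]
    (cylinder X j x).
Proof.
set F := sigma_family _ _.
have FI A B : F A -> F B -> F (A `&` B).
  exact: (@measurableI _ (g_sigma_algebraType
    (\bigcup_(k in [set k | (1 <= k <= n)%N]) sigma_of (X k : T -> R)))).
elim: j => [_|j IH jn].
  rewrite cylinder0.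
  exact: (@measurableT _ (g_sigma_algebraType
    (\bigcup_(k in [set k | (1 <= k <= n)%N]) sigma_of (X k : T -> R)))).
have -> : cylinder X j.+1 x = cylinder X j x `&` X j.+1 @^-1` [set x j.+1].
  rewrite -cylinder_extend; congr cylinder; apply/funext => k.
  by rewrite /extend; case: eqP => // ->.
apply: FI; first exact: (IH (ltnW jn)).
apply: sub_sigma_algebra; exists j.+1 => //=.
by exists [set x j.+1] => //; rewrite setTI.
Qed.

Lemma measurable_cylinder d (T : measurableType d) (R : realType)
    (P : probability T R) (X : nat -> {RV P >-> R}) (n : nat) (x : nat -> R) :
  measurable (cylinder X n x).
Proof.
have := @sigma_family_cylinder _ _ _ _ X n n x (leqnn n).
apply: smallest_sub; first exact: sigma_algebra_measurable.
move=> A [k _] [B mB <-]; exact: measurable_funP.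
Qed.

Lemma sigma_of_preimage d d' (T : measurableType d) (U : measurableType d')
    (R : realType) (P : probability T R) (Y : {RV P >-> U}) (B : set U) :
  measurable B -> sigma_of Y (Y @^-1` B).
Proof. by move=> mB; exists B => //; rewrite setTI. Qed.

(** Given the history and the index [k], the next step is [b] with probability
    [(1 + (2p - 1) b x_k) / 2]. Averaging over the uniform index turns [x_k] into
    [partial_sum n x / n]. *)
Lemma prob_cylinderS d (T : measurableType d) (R : realType)
    (P : probability T R) (p : R) (X : nat -> {RV P >-> R}) (n : nat)
    (x : nat -> R) (b : R) :
  elephant_random_walk P p X -> (0 < n)%N -> signs n x -> b = 1 \/ b = - 1 ->
  prob P (cylinder X n.+1 (extend n x b)) =
  prob P (cylinder X n x) * ((1 + b * ((2 * p - 1) * partial_sum n x / n%:R)) / 2).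
Proof.
move=> [_ [K [keep /(_ n)hK]]] n0 sx sb.
have {hK}[PK keep1 keep0 indep XS] := hK n0.
have n0' : n%:R != 0 :> R by rewrite pnatr_eq0 -lt0n.
have mC := measurable_cylinder X n x.
have mD := measurable_cylinder X n.+1 (extend n x b).
have mK B : measurable (K n @^-1` B).
  by rewrite -[X in measurable X]setTI; exact: measurable_funP.
have mkeep B : measurable (keep n @^-1` B).
  by rewrite -[X in measurable X]setTI; exact: measurable_funP.
(* The [n] weights [1 / n] already sum to 1, so the index falls outside [1..n] with probability
   0. *)
have K_in : prob P (K n @^-1` [set k | ~~ (1 <= k <= n)%N]) = 0.
  have := prob_partition (K n) n (@measurableT _ T).
  rewrite {1}/prob probability_setT /= setTI.
  under eq_big_nat => k kn do rewrite setTI /prob PK//=.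
  rewrite sumr_const_nat subn1/= -[_ *+ _]mulr_natl mulfV//.
  by move=> h; apply: (@addrI _ 1); rewrite addr0; exact/esym.
rewrite (prob_partition (K n) n mD).
have -> : prob P (cylinder X n.+1 (extend n x b) `&`
    K n @^-1` [set k | ~~ (1 <= k <= n)%N]) = 0.
  apply/eqP; rewrite eq_le prob_ge0 andbT -K_in; apply: le_prob => //.
  exact: measurableI.
rewrite addr0 (eq_big_nat _ _ (F2 := fun k => prob P (cylinder X n x) * n%:R^-1 *
    ((1 + (2 * p - 1) * b * x k) / 2))).
  rewrite -mulr_sumr -mulr_suml big_split/= -mulr_sumr sumr_const_nat subn1/=.
  by rewrite /partial_sum; field.
move=> k kn; rewrite ltnS in kn.
(* As [x k] and [b] are signs, the next step is [b] exactly when the coin says repeat and [x k = b],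
   or reverse and [x k <> b]. The event becomes an intersection of three independent ones. *)
have -> : cylinder X n.+1 (extend n x b) `&` K n @^-1` [set k] =
    cylinder X n x `&` K n @^-1` [set k] `&` keep n @^-1` [set (x k == b)].
  rewrite cylinder_extend; apply/seteqP; split => w /=.
    move=> [[hC]]; rewrite XS => + Kk; rewrite Kk hC// => hb; split => //.
    have x1 : x k != - x k.
      by have [->|->] := sx k kn; apply/eqP; lra.
    case: ifP hb => _ <-; first by rewrite eqxx.
    exact/esym/negbTE.
  move=> [[hC Kk] hk]; split => //; split => //.
  rewrite XS Kk hC// hk; case: eqP => // /eqP xb.
  by move: xb; have [->|->] := sx k kn; have [->|->] := sb; rewrite ?eqxx// ?opprK.
have := indep _ (K n @^-1` [set k]) (keep n @^-1` [set (x k == b)])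
  (@sigma_family_cylinder _ _ _ _ X n n x (leqnn n)).
rewrite PK// (probE P mC) => indepk.
rewrite {1}/prob indepk; try exact: sigma_of_preimage.
have -> : P (keep n @^-1` [set x k == b]) = ((1 + (2 * p - 1) * b * x k) / 2)%:E.
  have [] := sx k kn => ->; have [] := sb => ->; rewrite ?eqxx ?keep1.
  - by congr EFin; lra.
  - have -> : (1 == -1 :> R) = false by apply/eqP; lra.
    by rewrite keep0; congr EFin; lra.
  - have -> : (-1 == 1 :> R) = false by apply/eqP; lra.
    by rewrite keep0; congr EFin; lra.
  - by congr EFin; lra.
by rewrite -!EFinM.
Qed.

(** The transition probabilities to [+1] and [-1] sum to 1, so any other value of the next step has
    probability 0 on this history. *)
Lemma prob_cylinder_split d (T : measurableType d) (R : realType)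
    (P : probability T R) (p : R) (X : nat -> {RV P >-> R}) (n : nat)
    (x : nat -> R) (E : set T) :
  elephant_random_walk P p X -> (0 < n)%N -> signs n x -> measurable E ->
  prob P (cylinder X n x `&` E) <=
  prob P (cylinder X n.+1 (extend n x 1) `&` E) +
  prob P (cylinder X n.+1 (extend n x (- 1)) `&` E).
Proof.
move=> hX n0 sx mE.
have mC := measurable_cylinder X n x.
have mX b : measurable (X n.+1 @^-1` [set b]).
  by rewrite -[X in measurable X]setTI; exact: measurable_funP.
have three_parts A : measurable A -> prob P A = prob P (A `&` X n.+1 @^-1` [set 1]) +
    prob P (A `&` X n.+1 @^-1` [set -1]) +
    prob P (A `&` (~` X n.+1 @^-1` [set 1] `&` ~` X n.+1 @^-1` [set -1])).
  move=> mA; rewrite (prob_split P mA (mX 1)) -addrA; congr +%R.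
  have mA' : measurable (A `&` ~` X n.+1 @^-1` [set 1]).
    by apply: measurableI => //; exact: measurableC.
  rewrite (prob_split P mA' (mX (-1))) -setIA; congr (prob P (A `&` _) + _);
    last by rewrite setIA.
  by apply/seteqP; split => w /= [// ->]; split => //; lra.
have mN : measurable (~` X n.+1 @^-1` [set 1] `&` ~` X n.+1 @^-1` [set -1]).
  by apply: measurableI; exact: measurableC.
have N0 : prob P (cylinder X n x `&`
    (~` X n.+1 @^-1` [set 1] `&` ~` X n.+1 @^-1` [set -1])) = 0.
  have := three_parts _ mC; rewrite -!cylinder_extend.
  rewrite !(prob_cylinderS hX n0 sx); [|by right|by left].
  by lra.
rewrite (three_parts _ (measurableI _ _ mC mE)) !cylinder_extend.
rewrite -[leRHS]addr0.
rewrite !lerD//; try by rewrite le_eqVlt setIAC eqxx.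
rewrite -N0; apply: le_prob.
- by apply: measurableI => //; exact: measurableI.
- exact: measurableI.
- by move=> w [[]].
Qed.

(** Total probability over sign histories without enumerating them: the bound is carried back one
    step at a time from [m] to time 1, where the history is certain. *)
Lemma prob_le_of_histories d (T : measurableType d) (R : realType)
    (P : probability T R) (p : R) (X : nat -> {RV P >-> R}) (m : nat)
    (E : set T) (c : R) :
  elephant_random_walk P p X -> (0 < m)%N -> measurable E ->
  (forall x, signs m x ->
    prob P (cylinder X m x `&` E) <= prob P (cylinder X m x) * c) ->
  prob P E <= c.
Proof.
move=> hX m0 mE hE.
suff H k n x : m = (n + k)%N -> (0 < n)%N -> signs n x ->
    prob P (cylinder X n x `&` E) <= prob P (cylinder X n x) * c.
  have [X1 _] := hX.
  have := H m.-1 1%N (fun=> 1); rewrite cylinder1// setTI.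
  rewrite {2}/prob probability_setT mul1r.
  by apply => //; [rewrite add1n prednK | left].
elim: k n x => [n x|k IH n x mk n0 sx].
  by rewrite addn0 => <- _; exact: hE.
apply: (le_trans (prob_cylinder_split hX n0 sx mE)).
have s1 := signs_extend sx (or_introl erefl : 1 = 1 \/ 1 = -1).
have s2 := signs_extend sx (or_intror erefl : -1 = 1 \/ -1 = -1).
have mk' : m = (n.+1 + k)%N by rewrite addSnnS.
apply: (le_trans (lerD (IH _ _ mk' _ s1) (IH _ _ mk' _ s2))) => //.
rewrite !(prob_cylinderS hX n0 sx); [|by right|by left].
by lra.
Qed.

Lemma position_cylinder d (T : measurableType d) (R : realType)
    (P : probability T R) (X : nat -> {RV P >-> R}) (n : nat) (x : nat -> R)
    (w : T) :
  cylinder X n x w -> position P X n w = partial_sum n x.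
Proof.
by move=> hw; apply: eq_big_nat => k; rewrite ltnS => /hw.
Qed.

Lemma measurable_position d (T : measurableType d) (R : realType)
    (P : probability T R) (X : nat -> {RV P >-> R}) (n : nat) :
  measurable_fun setT (position P X n).
Proof. by apply: measurable_sum. Qed.

(** * The maximal inequality and its martingale form *)

Definition exceedance d (T : measurableType d) (R : realType)
    (P : probability T R) (X : nat -> {RV P >-> R}) (G : nat -> R -> R)
    (lam : R) (n : nat) : set T :=
  [set w | exists2 j, (n <= j)%N & lam <= G j (position P X j w)].

Lemma measurable_level d (T : measurableType d) (R : realType)
    (P : probability T R) (X : nat -> {RV P >-> R}) (g : R -> R) (lam : R)
    (j : nat) :
  measurable_fun setT g -> measurable [set w | lam <= g (position P X j w)].
Proof.
move=> mg; rewrite -[X in measurable X]setTI.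
have -> : [set w | lam <= g (position P X j w)] =
  (g \o position P X j) @^-1` `[lam, +oo[.
  by apply/seteqP; split => w /=; rewrite in_itv/= andbT.
exact: (measurableT_comp mg (measurable_position X j)).
Qed.

Lemma measurable_exceedance d (T : measurableType d) (R : realType)
    (P : probability T R) (X : nat -> {RV P >-> R}) (G : nat -> R -> R)
    (lam : R) (n : nat) :
  (forall j, measurable_fun setT (G j)) ->
  measurable (exceedance X G lam n).
Proof.
move=> mG.
have -> : exceedance X G lam n =
  \bigcup_(j in [set j | (n <= j)%N]) [set w | lam <= G j (position P X j w)].
  by apply/seteqP; split=> w [j nj hj]; exists j.
by apply: bigcup_measurable => j _; exact: measurable_level.
Qed.

(** Ville's inequality for nonnegative supermartingales, conditional on a history. *)
Lemma maximal_inequality d (T : measurableType d) (R : realType)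
    (P : probability T R) (p : R) (X : nat -> {RV P >-> R})
    (G : nat -> R -> R) (lam : R) (n : nat) (x : nat -> R) :
  elephant_random_walk P p X -> excessive (2 * p - 1) 1 G ->
  (forall j s, (0 < j)%N -> 0 <= G j s) ->
  (forall j, measurable_fun setT (G j)) ->
  0 < lam -> (0 < n)%N -> signs n x ->
  prob P (cylinder X n x `&` exceedance X G lam n) <=
  prob P (cylinder X n x) * (G n (partial_sum n x) / lam).
Proof.
move=> hX exG G0 mG lam0 n0 sx.
(* Crossings of the level between times [m] and [N]; the finite horizon permits an induction on the
   time left. *)
pose F m N := \bigcup_(j in [set j | (m <= j <= N)%N])
  [set w | lam <= G j (position P X j w)].
have mF m N : measurable (F m N).
  by apply: bigcup_measurable => j _; exact: measurable_level.
have mC m y := measurable_cylinder X m y.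
have FS m N : F m N `<=` [set w | lam <= G m (position P X m w)] `|` F m.+1 N.
  move=> w [j /andP[]]; rewrite leq_eqVlt => /predU1P[<- _ ?|mj jN ?].
    by left.
  by right; exists j => //; rewrite /= mj.
(* If the level is already reached at time [m], the factor [G / lam] is at least 1. *)
have trivial_bound m y E : measurable E -> lam <= G m (partial_sum m y) ->
    prob P (cylinder X m y `&` E) <=
    prob P (cylinder X m y) * (G m (partial_sum m y) / lam).
  move=> mE lG; apply: (@le_trans _ _ (prob P (cylinder X m y))).
    by apply: le_prob => //; exact: measurableI.
  by rewrite ler_peMr ?prob_ge0// ler_pdivlMr// mul1r.
have bound k N m y : (N <= m + k)%N -> (0 < m)%N -> signs m y ->
    prob P (cylinder X m y `&` F m N) <=
    prob P (cylinder X m y) * (G m (partial_sum m y) / lam).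
  elim: k m y => [|k IH] m y Nm m0 sy; have [lG|Gl] := leP lam (G m (partial_sum m y)).
  - exact: trivial_bound.
  - have -> : cylinder X m y `&` F m N = set0.
      rewrite -subset0 => w [hw /FS[/=|[j /= /andP[mj jN]]]].
        by rewrite (position_cylinder hw) leNgt Gl.
      by move: (leq_trans mj (leq_trans jN Nm)); rewrite addn0 ltnn.
    by rewrite /prob measure0 mulr_ge0 ?prob_ge0// divr_ge0 ?G0// ltW.
  - exact: trivial_bound.
  have Nm' : (N <= m.+1 + k)%N by rewrite addSnnS.
  have s1 := signs_extend sy (or_introl erefl : 1 = 1 \/ 1 = -1).
  have s2 := signs_extend sy (or_intror erefl : -1 = 1 \/ -1 = -1).
  (* Below the level at time [m], a crossing must come later; splitting on the next step leaves the
     average of [G m.+1], bounded through [exG]. *)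
  apply: (@le_trans _ _ (prob P (cylinder X m y `&` F m.+1 N))).
    apply: le_prob; [exact: measurableI|exact: measurableI|].
    move=> w [hw /FS[|//]] /=.
    by rewrite (position_cylinder hw) leNgt Gl.
  apply: (le_trans (prob_cylinder_split hX m0 sy (mF _ _))).
  apply: (le_trans (lerD (IH _ _ Nm' _ s1) (IH _ _ Nm' _ s2))) => //.
  rewrite !(prob_cylinderS hX m0 sy); [|by right|by left].
  rewrite !partial_sum_extend -!mulrA -mulrDr ler_wpM2l ?prob_ge0//.
  rewrite !mulrA -mulrDl ler_wpM2r ?invr_ge0 ?(ltW lam0)//.
  by have := exG m (partial_sum m y) m0; lra.
have -> : cylinder X n x `&` exceedance X G lam n =
    \bigcup_N (cylinder X n x `&` F n N).
  apply/seteqP; split => w.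
    move=> [hw [j nj hj]]; exists j => //; split => //.
    by exists j => //=; rewrite nj leqnn.
  by move=> [N _ [hw [j /andP[nj _] hj]]]; split => //; exists j.
apply: prob_bigcup_le => [N|N N' NN'|N]; first exact: measurableI.
  apply/subsetPset => w [hw [j /andP[nj jN] hj]]; split => //.
  by exists j => //=; rewrite nj (leq_trans jN).
by apply: (bound N) => //; rewrite leq_addl.
Qed.

Lemma maximal_inequality_init d (T : measurableType d) (R : realType)
    (P : probability T R) (p : R) (X : nat -> {RV P >-> R})
    (G : nat -> R -> R) (lam : R) :
  elephant_random_walk P p X -> excessive (2 * p - 1) 1 G ->
  (forall j s, (0 < j)%N -> 0 <= G j s) ->
  (forall j, measurable_fun setT (G j)) ->
  0 < lam -> prob P (exceedance X G lam 1) <= G 1%N 1 / lam.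
Proof.
move=> hX exG G0 mG lam0.
have s1 : signs 1 (fun=> 1 : R) by left.
have := maximal_inequality hX exG G0 mG lam0 (ltn0Sn 0) s1.
have [X1 _] := hX.
by rewrite cylinder1// setTI /partial_sum big_nat1 {2}/prob probability_setT mul1r.
Qed.

(** Kolmogorov's inequality: the superharmonic square is centred at the martingale's value [r] on
    the given history, so at time [n] only the tail variance remains. *)
Lemma prob_martingale_deviation d (T : measurableType d) (R : realType)
    (P : probability T R) (p : R) (X : nat -> {RV P >-> R})
    (lam : R) (n : nat) (x : nat -> R) :
  let a := 2 * p - 1 in
  let E := [set w | exists2 j, (n <= j)%N & lam <=
    (position P X j w / growth a j - position P X n w / growth a n) ^+ 2] in
  elephant_random_walk P p X -> 1 / 2 < a < 1 -> 0 < lam -> (0 < n)%N ->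
  measurable E /\ (signs n x ->
    prob P (cylinder X n x `&` E) <=
    prob P (cylinder X n x) * (tail_variance a n / lam)).
Proof.
move=> a E hX ha lam0 n0; have /andP[ha0 _] := ha.
have mE : measurable E.
  have -> : E = \bigcup_(j in [set j | (n <= j)%N]) ((fun w =>
    (position P X j w / growth a j - position P X n w / growth a n) ^+ 2)
      @^-1` `[lam, +oo[).
    by apply/seteqP; split=> w [j nj /= hj]; exists j => //; move: hj;
      rewrite /= in_itv/= andbT.
  apply: bigcup_measurable => j _; rewrite -[X in measurable X]setTI.
  suff : measurable_fun setT (fun w => (position P X j w / growth a j -
      position P X n w / growth a n) ^+ 2) by apply.
  apply: measurable_funX; apply: measurable_funB;
    by apply: measurable_funM => //; exact: measurable_position.
split => // sx; pose r := partial_sum n x / growth a n.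
pose G j s := (s / growth a j - r) ^+ 2 + tail_variance a j.
have G0 j s : (0 < j)%N -> 0 <= G j s.
  by move=> _; rewrite addr_ge0 ?sqr_ge0// tail_variance_ge0.
have mG j : measurable_fun setT (G j).
  apply: measurable_funD => //; apply: measurable_funX.
  by apply: measurable_funB => //; exact: measurable_funM.
have -> : tail_variance a n = G n (partial_sum n x).
  by rewrite /G -/r subrr expr0n add0r.
apply: le_trans
  (maximal_inequality hX (excessive_martingale r ha) G0 mG lam0 n0 sx).
have mC := measurable_cylinder X n x.
apply: le_prob.
- exact: measurableI.
- by apply: measurableI => //; exact: measurable_exceedance.
move=> w [hw [j nj hj]]; split => //; exists j => //.
apply: (le_trans hj); rewrite (position_cylinder hw) -/r lerDl.
exact: tail_variance_ge0.
Qed.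

(** * Convergence criteria and almost sure limits *)

Lemma invr_nat_lt (R : realType) (e : R) : 0 < e ->
  exists i : nat, i.+1%:R^-1 < e.
Proof.
by move=> e0; have [i] := @ltr_add_invr R 0 e e0; rewrite add0r; exists i.
Qed.

(** Countably many thresholds [1 / (j + 1)] fit [ae_forall_small], and squares fit the quadratic
    potentials; likewise for the Cauchy criterion below. *)
Lemma cvg0_of_sqr (R : realType) (u : nat -> R) :
  (forall j : nat, \forall n \near \oo, u n ^+ 2 < j.+1%:R^-1) ->
  u n @[n --> \oo] --> (0 : R).
Proof.
move=> h; apply/cvgr0Pnorm_lt => e e0.
have [j je] : exists j : nat, j.+1%:R^-1 < e ^+ 2.
  by apply: invr_nat_lt; rewrite exprn_gt0.
near=> n; rewrite -(@ltr_pXn2r _ 2)// ?nnegrE ?(ltW e0)//.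
rewrite real_normK ?num_real//; apply: lt_trans je.
by near: n; exact: h.
Unshelve. all: by end_near. Qed.

Lemma is_cvg_of_sqr (R : realType) (u : nat -> R) :
  (forall j : nat, exists m : nat, forall n, (m <= n)%N ->
     (u n - u m) ^+ 2 < j.+1%:R^-1) ->
  cvgn u.
Proof.
move=> h; apply: cauchy_cvg; apply: cauchy_exP => e e0.
have [j je] : exists j : nat, j.+1%:R^-1 < e ^+ 2.
  by apply: invr_nat_lt; rewrite exprn_gt0.
have [m hm] := h j; exists (u m).
exists m => // n /= mn; rewrite /ball/= distrC.
rewrite -(@ltr_pXn2r _ 2)// ?nnegrE ?(ltW e0)//.
by rewrite real_normK ?num_real// (lt_trans _ je)// hm.
Qed.

Lemma position_critical_cvg0 d (T : measurableType d) (R : realType)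
    (P : probability T R) (p : R) (X : nat -> {RV P >-> R}) :
  elephant_random_walk P p X -> 2 * p - 1 <= 1 / 2 ->
  {ae P, forall w,
    position P X n w / (Num.sqrt n%:R * ln n%:R) @[n --> \oo] --> (0 : R)}.
Proof.
move=> hX hp.
suff : {ae P, forall w, forall j : nat, \forall n \near \oo,
    (position P X n w / (Num.sqrt n%:R * ln n%:R)) ^+ 2 < j.+1%:R^-1}.
  by apply: filterS => w; exact: cvg0_of_sqr.
apply: ae_forall_small => j e e0.
have lam0 : 0 < j.+1%:R^-1 :> R by rewrite invr_gt0.
have [m [m1 me]] : exists m, (1 < m)%N /\
    critical_potential m 1 (1 : R) < e * j.+1%:R^-1.
  have ej : 0 < e * j.+1%:R^-1 by rewrite mulr_gt0.
  have [m _ hm] : \forall m \near \oo, (1 < m)%N /\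
      critical_potential m 1 (1 : R) < e * j.+1%:R^-1.
    near=> m; split; first by near: m; exact: nbhs_infty_gt.
    by near: m; exact: (cvgr_lt _ (@critical_potential_cvg0 R) _ ej).
  by exists m; apply: hm => /=.
have mG i : measurable_fun setT (critical_potential m i : R -> R).
  by apply: measurable_funD => //; exact: measurable_funM.
exists (exceedance X (critical_potential m) j.+1%:R^-1 1); split.
- exact: measurable_exceedance.
- apply: (le_trans
    (maximal_inequality_init hX (excessive_critical m1 hp) _ mG lam0)).
    by move=> i s i0; exact: critical_potential_ge0.
  by rewrite ler_pdivrMr// ltW.
move=> w nE; exists m => // n /= mn; rewrite ltNge; apply/negP => hn; apply: nE.
have n0 : (0 < n)%N by rewrite (leq_trans _ mn)// ltnW.
(* For [n >= m] the potential is the squared normalised position plus [1 / ln n >= 0], so a large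
   square is an exceedance. *)
exists n => //; apply: (le_trans hn); rewrite /critical_potential (maxn_idPl mn).
rewrite subrr mul0r addr0 exprMn exprVn exprMn sqr_sqrtr// mulrC lerDl.
by rewrite invr_ge0 ln_ge0// ler1n.
Unshelve. all: by end_near. Qed.

Lemma martingale_cvg d (T : measurableType d) (R : realType)
    (P : probability T R) (p : R) (X : nat -> {RV P >-> R}) :
  let a := 2 * p - 1 in
  elephant_random_walk P p X -> 1 / 2 < a < 1 ->
  {ae P, forall w, cvgn (fun n => position P X n w / growth a n)}.
Proof.
move=> a hX ha; have /andP[ha0 _] := ha.
suff : {ae P, forall w, forall j : nat, exists m : nat, forall n, (m <= n)%N ->
    (position P X n w / growth a n - position P X m w / growth a m) ^+ 2
      < j.+1%:R^-1}.
  by apply: filterS => w; exact: is_cvg_of_sqr.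
apply: ae_forall_small => j e e0.
have lam0 : 0 < j.+1%:R^-1 :> R by rewrite invr_gt0.
have [m [m0 me]] : exists m, (0 < m)%N /\ tail_variance a m < e * j.+1%:R^-1.
  have ej : 0 < e * j.+1%:R^-1 by rewrite mulr_gt0.
  have [m _ hm] : \forall m \near \oo,
      (0 < m)%N /\ tail_variance a m < e * j.+1%:R^-1.
    near=> m; split; first by near: m; exact: nbhs_infty_gt.
    by near: m; exact: (cvgr_lt _ (tail_variance_cvg0 ha0) _ ej).
  by exists m; apply: hm => /=.
have dev x := prob_martingale_deviation x hX ha lam0 m0.
(* The deviation event does not depend on the history, so any one yields its measurability. *)
have [mE _] := dev (fun=> 1).
eexists; split; first exact: mE.
  have := prob_le_of_histories hX m0 mE (fun x => (dev x).2).
  by move/le_trans; apply; rewrite ler_pdivrMr// ltW.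
move=> w nE; exists m => n mn; rewrite ltNge; apply/negP => hn.
by apply: nE; exists n.
Unshelve. all: by end_near. Qed.

(** * Non-degeneracy of the supercritical limit *)

(** After [n] steps [+1], the next step is [+1] with probability [(1 + (2p - 1)) / 2 = p]. *)
Lemma prob_cylinder_ones_gt0 d (T : measurableType d) (R : realType)
    (P : probability T R) (p : R) (X : nat -> {RV P >-> R}) (n : nat) :
  elephant_random_walk P p X -> 0 < p -> (0 < n)%N ->
  0 < prob P (cylinder X n (fun=> 1)).
Proof.
move=> hX p0; elim: n => // -[_ _|n IH _].
  by have [X1 _] := hX; rewrite cylinder1// /prob probability_setT.
have -> : (fun=> 1) = extend n.+1 (fun=> 1) 1 :> (nat -> R).
  by apply/funext => k; rewrite /extend; case: ifP.
have s1 : signs n.+1 (fun=> 1 : R) by left.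
rewrite (prob_cylinderS hX _ s1)//; last by left.
rewrite mulr_gt0 ?IH// /partial_sum sumr_const_nat subn1/= -[1 *+ _]mulr_natl mulr1.
by rewrite mulfK ?pnatr_eq0//; lra.
Qed.

Lemma nondegenerate_limit d (T : measurableType d) (R : realType)
    (P : probability T R) (p : R) (X : nat -> {RV P >-> R}) (L : {RV P >-> R}) :
  let a := 2 * p - 1 in
  elephant_random_walk P p X -> 1 / 2 < a < 1 ->
  {ae P, forall w, position P X n w / n%:R `^ a @[n --> \oo] --> L w} ->
  nondegenerate_rv P L.
Proof.
move=> a hX ha cvL c Lc; have /andP[ha0 a1] := ha.
have ha' : 0 < a < 1 by apply/andP; split; lra.
have p0 : 0 < p by move: ha0; rewrite /a; lra.
have [kappa k0 hk] := growth_powR_cvg ha'.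
(* The factor [kappa] converts between the normalisations [growth a n] and [n^a]. Of the 2, one unit
   allows for later deviation and one keeps the limit above [c]. *)
have [m [m0 tm mg]] : exists m, [/\ (0 < m)%N, tail_variance a m < 1 &
    c / kappa + 2 <= m%:R / growth a m].
  have [m _ hm] : \forall m \near \oo, [/\ (0 < m)%N, tail_variance a m < 1 &
      c / kappa + 2 <= m%:R / growth a m].
    have /cvgryPge hg := id_over_growth_cvg ha'.
    near=> m; split; first by near: m; exact: nbhs_infty_gt.
      by near: m; exact: (cvgr_lt _ (tail_variance_cvg0 ha0) _ ltr01).
    by near: m; exact: hg.
  by exists m; apply: hm => /=.
have [mE] := prob_martingale_deviation (fun=> 1) hX ha ltr01 m0.
set E := [set w | _] in mE *; set C := cylinder _ _ _ => hE.
have {}hE := hE (fun _ _ => or_introl erefl).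
have mC : measurable C := measurable_cylinder X m _.
have C0 : 0 < prob P C by exact: prob_cylinder_ones_gt0 hX p0 m0.
have CE : 0 < prob P (C `&` ~` E).
  have := prob_split P mC mE; move: hE; rewrite divr1.
  have : prob P C * tail_variance a m < prob P C * 1 by rewrite ltr_pM2l.
  by lra.
have mCE : measurable (C `&` ~` E) by apply: measurableI => //; exact: measurableC.
suff : P.-negligible (C `&` ~` E).
  by move/(negligibleP P mCE) => CE0; move: CE; rewrite /prob CE0 ltxx.
have : {ae P, forall w, ~ (C `&` ~` E) w}.
  move: cvL Lc; apply: filterS2 => w hL Lwc [hC nE].
  rewrite Lwc in hL.
  have tot : position P X m w = m%:R.
    by rewrite (position_cylinder hC) /partial_sum sumr_const_nat subn1.
  have low n : (m <= n)%N -> c / kappa + 1 <= position P X n w / growth a n.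
    move=> mn; rewrite leNgt; apply/negP => hn; apply: nE; exists n => //=.
    have aux (u v z : R) : u < z + 1 -> z + 2 <= v -> 1 <= (u - v) ^+ 2.
      by move=> uz zv; nra.
    by rewrite tot; exact: aux hn mg.
  have h1 : (c / kappa + 1) * (growth a n / n%:R `^ a) @[n --> \oo] -->
      (c / kappa + 1) * kappa by apply: cvgMr.
  (* Passing to the limit in [low] yields [c + kappa <= c], a contradiction. *)
  have : (c / kappa + 1) * kappa <= c.
    apply: (ler_cvg_to h1 hL); exists m => // n /= mn.
    have g0 : 0 < growth a n by rewrite growth_gt0//; lra.
    have -> : position P X n w / n%:R `^ a =
        position P X n w / growth a n * (growth a n / n%:R `^ a).
      by rewrite mulrA divfK// gt_eqF.
    by rewrite ler_wpM2r ?low// divr_ge0 ?powR_ge0// ltW.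
  by rewrite mulrDl divfK ?gt_eqF// mul1r; lra.
rewrite /almost_everywhere; congr (_.-negligible _).
by apply/seteqP; split => w /=; [move/contrapT|move=> ? ?].
Unshelve. all: by end_near. Qed.

(** * The limits in the remaining regimes and the random first step *)

(** Follows from the critical normalisation, because [sqrt n * ln n <= 2 n]. *)
Lemma position_cvg0 d (T : measurableType d) (R : realType)
    (P : probability T R) (p : R) (X : nat -> {RV P >-> R}) :
  elephant_random_walk P p X -> 2 * p - 1 <= 1 / 2 ->
  {ae P, forall w, position P X n w / n%:R @[n --> \oo] --> (0 : R)}.
Proof.
move=> hX hp; have := position_critical_cvg0 hX hp; apply: filterS => w h.
have h2 : 2 * `|position P X n w / (Num.sqrt n%:R * ln n%:R)|
    @[n --> \oo] --> (0 : R).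
  rewrite -(mulr0 2) -(@normr0 _ R).
  by apply: cvgM; [exact: cvg_cst|exact: cvg_norm].
apply/norm_cvg0P; apply: (squeeze_cvgr (f := fun=> 0) _ _ h2); last exact: cvg_cst.
near=> n; rewrite normr_ge0/=.
have n1 : (1 < n)%N by near: n; exact: nbhs_infty_gt.
have n0 : 0 < n%:R :> R by rewrite ltr0n ltnW.
have l0 : 0 < ln n%:R :> R by rewrite ln_gt0// ltr1n.
have s0 : 0 < Num.sqrt n%:R :> R by rewrite sqrtr_gt0.
rewrite !normrM !normfV mulrCA ler_wpM2l// (gtr0_norm n0).
rewrite gtr0_norm ?mulr_gt0// ler_pdivlMr ?mulr_gt0// ler_pdivrMl//.
apply: (le_trans (ler_wpM2l (ltW s0) (ln_le_sqrt n0))).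
by rewrite mulrCA -expr2 sqr_sqrtr ?(ltW n0)// mulrC.
Unshelve. all: by end_near. Qed.

Lemma position_supercritical_cvg d (T : measurableType d) (R : realType)
    (P : probability T R) (p : R) (X : nat -> {RV P >-> R}) :
  elephant_random_walk P p X -> 1 / 2 < 2 * p - 1 < 1 ->
  exists L : {RV P >-> R},
    {ae P, forall w,
      position P X n w / n%:R `^ (2 * p - 1) @[n --> \oo] --> L w}.
Proof.
move=> hX ha; set a := 2 * p - 1 in ha *; have /andP[ha0 a1] := ha.
have ha' : 0 < a < 1 by apply/andP; split; lra.
have [kappa _ hk] := growth_powR_cvg ha'.
pose f n w := (position P X n w / n%:R `^ a)%:E.
(* An upper limit in the extended reals exists and is measurable everywhere; [fine] gives a real
   variable equal to the limit wherever the martingale converges. *)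
have mL : measurable_fun setT (fun w => fine (limn_esup (f ^~ w))).
  apply: (measurableT_comp (fine_measurable measurableT)).
  apply: measurable_fun_limn_esup => n; apply/measurable_EFinP.
  by apply: measurable_funM => //; exact: measurable_position.
exists (mfun_Sub (mem_set mL)).
have := martingale_cvg hX ha; apply: filterS => w cM /=.
have cf : position P X n w / n%:R `^ a @[n --> \oo] -->
    limn (fun n => position P X n w / growth a n) * kappa.
  apply: (cvg_trans _ (cvgM cM hk)); apply: near_eq_cvg; near=> n.
  have g0 : 0 < growth a n by rewrite growth_gt0//; lra.
  by rewrite /= mulrA divfK// gt_eqF.
suff -> : fine (limn_esup (f ^~ w)) =
    limn (fun n => position P X n w / growth a n) * kappa by [].
have cE : f n w @[n --> \oo] -->
    (limn (fun n => position P X n w / growth a n) * kappa)%:E.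
  by apply: cvg_EFin => //; exact: nearW.
rewrite is_cvg_limn_esupE; last by apply/cvg_ex; eexists; exact: cE.
by rewrite (cvg_lim _ cE).
Unshelve. all: by end_near. Qed.

Theorem theorem4p1 (d : measure_display) (T : measurableType d) (R : realType)
    (P : probability T R) (p : R) (X : nat -> {RV P >-> R})
    (Y : {RV P >-> R}) (S : nat -> T -> R)
    (hp : 0 < p < 1)
    (hX : elephant_random_walk P p X)
    (hY : independent2 P (sigma_of Y)
            (sigma_family (fun k => X k : T -> R) [set k | (1 <= k)%N]))
    (hS : forall n w, (1 <= n)%N -> S n w = Y w * position P X n w) :
  [/\ p < 3 / 4 ->
        {ae P, forall w, S n w / n%:R @[n --> \oo] --> (0 : R)},
      p = 3 / 4 ->
        {ae P, forall w,
          S n w / (Num.sqrt n%:R * ln n%:R) @[n --> \oo] --> (0 : R)}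
    & 3 / 4 < p ->
        exists L : {RV P >-> R},
          [/\ nondegenerate_rv P L,
              {ae P, forall w,
                position P X n w / (n%:R `^ (2 * p - 1)) @[n --> \oo] --> L w}
            & {ae P, forall w,
                S n w / (n%:R `^ (2 * p - 1)) @[n --> \oo] --> Y w * L w}]].
Proof.
(* Each claim about [S] is the claim about the walk multiplied pointwise by [Y w]; the formula for
   [S n] is available once [n >= 1]. *)
have scale (u : nat -> R) w l :
    position P X n w / u n @[n --> \oo] --> l ->
    S n w / u n @[n --> \oo] --> Y w * l.
  move=> h; apply: (cvg_trans _ (cvgM (cvg_cst (Y w)) h)).
  apply: near_eq_cvg; near=> n; rewrite hS /= ?mulrA//.
  by near: n; exact: nbhs_infty_gt.
split=> [p34|p34|p34].
- have hp' : 2 * p - 1 <= 1 / 2 by lra.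
  have := position_cvg0 hX hp'; apply: filterS => w h.
  by have := scale (fun n => n%:R) w 0 h; rewrite mulr0.
- have hp' : 2 * p - 1 <= 1 / 2 by lra.
  have := position_critical_cvg0 hX hp'; apply: filterS => w h.
  by have := scale (fun n => Num.sqrt n%:R * ln n%:R) w 0 h; rewrite mulr0.
have ha : 1 / 2 < 2 * p - 1 < 1 by apply/andP; split; lra.
have [L hL] := position_supercritical_cvg hX ha.
exists L; split => //; first exact: nondegenerate_limit hX ha hL.
move: hL; apply: filterS => w h.
exact: (scale (fun n => n%:R `^ (2 * p - 1)) w (L w) h).
Unshelve. all: by end_near. Qed.
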